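(* Let $\cong$ be a congruence on LTSs such that $L\doteq L'$ implies $L\cong L'$, and $\cong$ preserves $\mathit{Sf}$ and $\mathit{Div}$ but does not preserve $\mathit{aenI}$. Then $\cong$ is the equivalence induced by $\Sigma$, $\mathit{Sf}$, $\mathit{Div}$ and $\mathit{eanI}$.
   Context: An LTS is a tuple $L=(S,\Sigma,\Delta,\hat s)$ with states $S$, alphabet $\Sigma$ (possibly infinite), $\tau\notin\Sigma$ a reserved invisible action, transitions $\Delta\subseteq S\times(\Sigma\cup\{\tau\})\times S$, initial state $\hat s$; $\Sigma(L)$ denotes the alphabet. Operators: action prefix $a.L$ ($a\neq\tau$): new initial state $\hat s'$, alphabet $\Sigma\cup\{a\}$, transitions $\Delta\cup\{(\hat s',a,\hat s)\}$. Hiding $L\setminus A$: alphabet $\Sigma\setminus A$, each transition labelled by an element of $A$ relabelled $\tau$, otherwise unchanged. Relational renaming $L\Phi$ ($\Phi$ a set of pairs, $\tau$ not in its domain $\mathcal D(\Phi)$ or range; $\Phi(a,b)$ means $(a,b)\in\Phi$ or $a=b\notin\mathcal D(\Phi)$): alphabet $\{b\mid\exists a\in\Sigma:\Phi(a,b)\}$, transitions $\{(s,b,s')\mid\exists a:(s,a,s')\in\Delta\wedge\Phi(a,b)\}$, same states and initial state. Parallel composition $L_1\|L_2$: states $S_1\times S_2$, alphabet $\Sigma_1\cup\Sigma_2$, initial $(\hat s_1,\hat s_2)$; actions in $\Sigma_1\cap\Sigma_2$ are taken jointly by both components, all other actions (including $\tau$) by one component while the other stays put. A congruence is an equivalence $\cong$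 with $L\cong L'\Rightarrow a.L\cong a.L',\ L\setminus A\cong L'\setminus A,\ L\Phi\cong L'\Phi,\ L\|L''\cong L'\|L'',\ L''\|L\cong L''\|L'$. For $\sigma=a_1\cdots a_n\in\Sigma^*$, $s\stackrel{\sigma}{\Rightarrow}s'$ means a finite path from $s$ to $s'$ whose non-$\tau$ labels are exactly $a_1,\dots,a_n$ in order; $\hat s\stackrel{\xi}{\Rightarrow}$ for $\xi\in\Sigma^\omega$ means an infinite path from $\hat s$ whose non-$\tau$ label sequence is $\xi$; $s\stackrel{\tau^\omega}{\to}$ means an infinite path of $\tau$-transitions from $s$. Define $\mathit{Tr}(L)=\{\sigma\in\Sigma^*\mid\exists s:\hat s\stackrel\sigma\Rightarrow s\}$, $\mathit{Div}(L)=\{\sigma\in\Sigma^*\mid\exists s:\hat s\stackrel\sigma\Rightarrow s\wedge s\stackrel{\tau^\omega}\to\}$, $\mathit{Inf}(L)=\{\xi\in\Sigma^\omega\mid\hat s\stackrel\xi\Rightarrow\}$, $\mathit{Sf}(L)=\{(\sigma,A)\in\Sigma^*\times2^\Sigma\mid\exists s:\hat s\stackrel\sigma\Rightarrow s\wedge\forall a\in A\cup\{\tau\}\,\forall s':(s,a,s')\notin\Delta\}$. Further $\mathit{eanI}(L)=\{a_1a_2\cdots\in\mathit{Inf}(L)\mid\exists n\ge0\,\forall i\ge n: a_1\cdots a_i\notin\mathit{Div}(L)\}$ and $\mathit{aenI}(L)=\{a_1a_2\cdots\in\mathit{Inf}(L)\mid\forall n\ge0\,\exists i\ge n: a_1\cdots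 a_i\notin\mathit{Div}(L)\}$. $L\doteq L'$ (CFFD-equivalence) iff $\Sigma,\mathit{Sf},\mathit{Div},\mathit{Inf}$ all agree on $L$ and $L'$. An equivalence preserves $X$ if $L\cong L'\Rightarrow X(L)=X(L')$; the equivalence induced by $\Sigma,X_1,\dots,X_k$ relates $L,L'$ iff all these functions agree on them. *)

(* Defs.v *)
From mathcomp Require Import all_boot.
From mathcomp Require Import mathcomp_extra boolp classical_sets functions.
From mathcomp Require Import cardinality.

Set Implicit Arguments.
Unset Strict Implicit.
Unset Printing Implicit Defensive.

Local Open Scope classical_set_scope.

(* Labels are of type [option Act]: [Some a] is the visible action [a] and
   [None] is tau.  Thus tau is in no alphabet, hiding set or renaming. *)
Record LTS (Act : Type) := MkLTS {
  state : Type;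
  alphabet : set Act;
  trans : state -> option Act -> state -> Prop;
  initial : state;
  trans_alphabet : forall s a s', trans s (Some a) s' -> alphabet a
}.

Section Operators.
Variable Act : Type.
Implicit Types (L : LTS Act) (a b : Act) (l : option Act).

(* [None : option (state L)] is the new initial state. *)
Inductive act_prefix_trans a L :
    option (state L) -> option Act -> option (state L) -> Prop :=
| ActPrefixFirst : act_prefix_trans a None (Some a) (Some (initial L))
| ActPrefixRest s l s' :
    trans s l s' -> act_prefix_trans a (Some s) l (Some s').

Lemma act_prefix_alphabet a L s b s' :
  @act_prefix_trans a L s (Some b) s' -> (alphabet L `|` [set a]) b.
Proof.
move=> H; inversion H; first by right.
by left; apply: trans_alphabet; eassumption.
Qed.

Definition act_prefix a L : LTS Act :=
  MkLTS None (@act_prefix_alphabet a L).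

Definition hide_trans (A : set Act) L (s : state L) l (s' : state L) : Prop :=
  match l with
  | Some b => trans s (Some b) s' /\ ~ A b
  | None => trans s None s' \/ exists2 a, A a & trans s (Some a) s'
  end.

Lemma hide_alphabet (A : set Act) L s b s' :
  @hide_trans A L s (Some b) s' -> (alphabet L `\` A) b.
Proof. by case=> t nAb; split=> //; apply: trans_alphabet t. Qed.

Definition hide L (A : set Act) : LTS Act :=
  MkLTS (initial L) (@hide_alphabet A L).

Definition renames (Phi : set (Act * Act)) a b : Prop :=
  Phi (a, b) \/ (a = b /\ ~ Phi.`1 a).

Definition renames_label (Phi : set (Act * Act)) l l' : Prop :=
  match l, l' with
  | Some a, Some b => renames Phi a b
  | None, None => True
  | _, _ => False
  end.

Definition rename_trans Phi L (s : state L) l (s' : state L) : Prop :=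
  exists2 l0, trans s l0 s' & renames_label Phi l0 l.

Lemma rename_alphabet Phi L s b s' :
  @rename_trans Phi L s (Some b) s' ->
  [set c | exists2 a, alphabet L a & renames Phi a c] b.
Proof.
by case=> -[a|] //= t ab; exists a => //; apply: trans_alphabet t.
Qed.

Definition rename L (Phi : set (Act * Act)) : LTS Act :=
  MkLTS (initial L) (@rename_alphabet Phi L).

Definition shared L1 L2 : set (option Act) :=
  Some @` (alphabet L1 `&` alphabet L2).

Inductive par_trans L1 L2 :
    state L1 * state L2 -> option Act -> state L1 * state L2 -> Prop :=
| ParSync s1 s2 l s1' s2' : shared L1 L2 l ->
    trans s1 l s1' -> trans s2 l s2' -> par_trans (s1, s2) l (s1', s2')
| ParLeft s1 s2 l s1' : ~ shared L1 L2 l ->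
    trans s1 l s1' -> par_trans (s1, s2) l (s1', s2)
| ParRight s1 s2 l s2' : ~ shared L1 L2 l ->
    trans s2 l s2' -> par_trans (s1, s2) l (s1, s2').

Lemma par_alphabet L1 L2 s b s' :
  @par_trans L1 L2 s (Some b) s' -> (alphabet L1 `|` alphabet L2) b.
Proof.
move=> H; inversion H; [left | left | right];
  apply: trans_alphabet; eassumption.
Qed.

Definition par L1 L2 : LTS Act :=
  MkLTS (initial L1, initial L2) (@par_alphabet L1 L2).

Record congruence (R : LTS Act -> LTS Act -> Prop) : Prop := Congruence {
  cong_equiv : RelationClasses.Equivalence R;
  cong_act_prefix : forall a L L',
    R L L' -> R (act_prefix a L) (act_prefix a L');
  cong_hide : forall A L L', R L L' -> R (hide L A) (hide L' A);
  cong_rename : forall Phi L L', R L L' -> R (rename L Phi) (rename L' Phi);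
  cong_parl : forall L'' L L', R L L' -> R (par L L'') (par L' L'');
  cong_parr : forall L'' L L', R L L' -> R (par L'' L) (par L'' L')
}.

Definition preserves (T : Type) (X : LTS Act -> T)
    (R : LTS Act -> LTS Act -> Prop) : Prop :=
  forall L L', R L L' -> X L = X L'.

End Operators.

Section Semantics.
Variables (Act : Type) (L : LTS Act).
Implicit Types (s : state L) (sigma : seq Act) (xi : nat -> Act).

Inductive fin_path : state L -> seq (option Act) -> state L -> Prop :=
| FinPathNil s : fin_path s [::] s
| FinPathCons s l s1 w s' :
    trans s l s1 -> fin_path s1 w s' -> fin_path s (l :: w) s'.

Definition weak s sigma s' : Prop :=
  exists2 w, fin_path s w s' & pmap id w = sigma.

Definition inf_path s (w : nat -> option Act) : Prop :=
  exists2 rho : nat -> state L, rho 0 = s &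
    forall i, trans (rho i) (w i) (rho i.+1).

Definition diverges s : Prop := inf_path s (fun=> None).

(* [xi] is the sequence of non-tau labels of [w], [k] enumerating their
   positions in increasing order. *)
Definition inf_visible (w : nat -> option Act) xi : Prop :=
  exists k : nat -> nat,
    [/\ forall i, k i < k i.+1,
        forall i, w (k i) = Some (xi i) &
        forall j, w j <> None -> exists i, j = k i].

Definition Div : set (seq Act) :=
  [set sigma | exists2 s, weak (initial L) sigma s & diverges s].

(* An infinite word [a_1 a_2 ...] is a function [xi : nat -> Act] with
   [xi i = a_(i+1)], so that [mkseq xi i] is [a_1 ... a_i]. *)
Definition Inf : set (nat -> Act) :=
  [set xi | exists2 w, inf_path (initial L) w & inf_visible w xi].

Definition Sf : set (seq Act * set Act) :=
  [set sA | sA.2 `<=` alphabet L /\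
    exists2 s, weak (initial L) sA.1 s &
      forall l, (Some @` sA.2 `|` [set None]) l -> forall s', ~ trans s l s'].

Definition eanI : set (nat -> Act) :=
  [set xi | Inf xi /\
    exists n, forall i, n <= i -> ~ Div (mkseq xi i)].

Definition aenI : set (nat -> Act) :=
  [set xi | Inf xi /\
    forall n, exists2 i, n <= i & ~ Div (mkseq xi i)].

End Semantics.

Definition cffd (Act : Type) (L L' : LTS Act) : Prop :=
  [/\ alphabet L = alphabet L', Sf L = Sf L', Div L = Div L' & Inf L = Inf L'].

(* Main.v *)
(* Actions are injected, together with countably many cues [cue i], back into
   the infinite set of actions.  Prefixing and renaming turn any infinite word
   [xi] into the word of all cues, and a controller put in parallel can then step
   an LTS along [xi] invisibly, at moments of its own choosing.

   Were [xi] in [Inf L] but not in [Inf L'] while eventually no prefix of [xi] is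
   in [Div], stepping along [xi] forever after some visible action would give a
   divergence for [L] only; so [R] preserves [eanI].

   Conversely, take [L], [L'] related by [R] and [xi] in [aenI L] only.  For any
   [M], let the controller either simulate [M], or follow an arbitrary infinite
   word with infinitely many prefixes in [Div M], making a step along [xi] at each
   of them.  Tours must leave no trace in [Sf] and [Div]: at visible traces in
   [Div M] the driven LTS may diverge, and at other traces the tour only rests at
   prefixes of [xi] outside [Div L], where [M] can take over.  Driving [L'] yields
   [M] up to [cffd]; driving [L] adds to [Inf M] all these words, and the result
   depends on [Sf M], [Div M] and [eanI M] only. *)
Require Import Defs.
From mathcomp Require Import all_boot.
From mathcomp Require Import mathcomp_extra boolp classical_sets functions.
From mathcomp Require Import cardinality.
From mathcomp Require Import zify.

Set Implicit Arguments.
Unset Strict Implicit.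
Unset Printing Implicit Defensive.

Local Open Scope classical_set_scope.

(** * Visible letters of infinite label sequences *)

Section Words.
Variable Act : Type.
Implicit Types (w : nat -> option Act) (xi : nat -> Act).

Definition letters (l : option Act) : seq Act := pmap id [:: l].

Definition vis w p : seq Act := pmap id (mkseq w p).

Lemma visS w p : vis w p.+1 = vis w p ++ letters (w p).
Proof. by rewrite /vis mkseqS -cats1 pmap_cat. Qed.

Lemma vis_prefix w p p' : p <= p' -> exists u, vis w p' = vis w p ++ u.
Proof.
move=> /subnKC <-; elim: (p' - p) => [|n [u IHn]].
  by exists [::]; rewrite addn0 cats0.
by exists (u ++ letters (w (p + n))); rewrite addnS visS IHn catA.
Qed.

Lemma leq_size_vis w p p' : p <= p' -> size (vis w p) <= size (vis w p').
Proof. by case/(vis_prefix w) => u ->; rewrite size_cat leq_addr. Qed.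

Lemma leq_of_size_vis w p p' : size (vis w p) < size (vis w p') -> p < p'.
Proof. by rewrite ltnNge => h; rewrite ltnNge; apply: contra h; apply: leq_size_vis. Qed.

Lemma vis_const w p p' : p <= p' ->
  (forall j, p <= j < p' -> w j = None) -> vis w p' = vis w p.
Proof.
move=> /subnKC <-; elim: (p' - p) => [|n IHn] h; first by rewrite addn0.
rewrite addnS visS h ?cats0 ?leq_addr ?addnS ?ltnSn//.
by apply: IHn => j /andP[pj jn]; apply: h; rewrite pj addnS ltnS ltnW.
Qed.

Lemma take_mkseq xi m n : m <= n -> take m (mkseq xi n) = mkseq xi m.
Proof. by move=> mn; rewrite /mkseq -map_take take_iota (minn_idPl mn). Qed.

Lemma mkseq_cat xi m n :
  mkseq xi (m + n) = mkseq xi m ++ [seq xi i | i <- iota m n].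
Proof. by rewrite /mkseq iotaD add0n map_cat. Qed.

Lemma vis_mkseq w xi : (forall n, exists p, vis w p = mkseq xi n) ->
  forall p, vis w p = mkseq xi (size (vis w p)).
Proof.
move=> h p; have [p' hp'] := h (size (vis w p)).+1.
have /ltnW/(vis_prefix w)[u hu] : p < p'.
  by apply: (@leq_of_size_vis w); rewrite hp' size_mkseq.
have := congr1 (take (size (vis w p))) hp'.
by rewrite hu take_size_cat// take_mkseq.
Qed.

(** Finite prefixes replace the enumeration [k] of positions, so that infinite words can be treated
    by induction. *)
Lemma inf_visibleP w xi :
  inf_visible w xi <-> forall n, exists p, vis w p = mkseq xi n.
Proof.
split=> [[k [kmono kSome kNone]] n|h].
  have kinc : {mono k : i j / i < j}.
    by apply: leqW_mono (leq_mono _); exact: homo_ltn ltn_trans kmono.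
  have notk j : (forall i, j <> k i) -> w j = None.
    by move=> hj; apply: contrapT => /kNone[i /hj].
  have hk m : vis w (k m) = mkseq xi m.
    elim: m => [|m IHm].
      rewrite -[RHS]/(vis w 0); apply: vis_const => // j /andP[_ jk].
      by apply: notk => i ji; move: jk; rewrite ji kinc.
    rewrite (@vis_const w (k m).+1) ?visS ?kSome ?IHm ?mkseqS ?cats1//.
    move=> j /andP[kj jk]; apply: notk => i ji; move: kj jk.
    by rewrite ji !kinc ltnS => mi im; move: (leq_trans mi im); rewrite ltnn.
  by exists (k n); exact: hk.
(* The letter [xi n] is the last label of the shortest prefix showing more than [n] letters. *)
have pick n : exists p, w p = Some (xi n) /\ vis w p = mkseq xi n.
  have exn : exists p, n < size (vis w p).
    by have [p hp] := h n.+1; exists p; rewrite hp size_mkseq.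
  case: (ex_minnP exn) => -[//|p] hn pmin.
  have le_n : size (vis w p) <= n.
    by rewrite leqNgt; apply/negP => /pmin; rewrite ltnn.
  move: hn (vis_mkseq h p.+1); rewrite visS size_cat.
  case e: (w p) => [a|] /=; last by rewrite addn0 ltnNge le_n.
  rewrite addn1 ltnS => ge_n.
  have sz : size (vis w p) = n by apply/eqP; rewrite eqn_leq le_n ge_n.
  rewrite sz mkseqS -cats1 => /(congr1 (drop n)).
  rewrite !drop_size_cat ?size_mkseq// => -[ea].
  by exists p; rewrite (vis_mkseq h p) sz e ea.
have [k hk] := choice pick.
have sz n : size (vis w (k n)) = n by rewrite (hk n).2 size_mkseq.
exists k; split=> [i|i|j wj].
- by apply: (@leq_of_size_vis w); rewrite !sz.
- by rewrite (hk i).1.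
exists (size (vis w j)); set n := size _.
have step p : w p <> None -> size (vis w p.+1) = (size (vis w p)).+1.
  by case: (w p) (visS w p) => // a -> _; rewrite size_cat addn1.
case: (ltngtP j (k n)) => // [jk|kj].
  by have := leq_size_vis w jk; rewrite step// sz ltnn.
by have := leq_size_vis w kj; rewrite step ?(hk n).1// sz ltnn.
Qed.

End Words.

(** * Weak transitions, divergence and infinite traces *)

Section Weak.
Variables (Act : Type) (L : LTS Act).
Implicit Types (s : state L) (sigma rho : seq Act).

Lemma fin_path_cat s u s1 v s' :
  fin_path s u s1 -> fin_path s1 v s' -> fin_path s (u ++ v) s'.
Proof.
move=> p; elim: p v s' => {s u s1} // s l s1 u s2 t _ IH v s' q.
by apply: FinPathCons t _; apply: IH.
Qed.

Lemma weak_refl s : weak s [::] s.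
Proof. by exists [::] => //; constructor. Qed.

Lemma weak_step s l s' : trans s l s' -> weak s (letters l) s'.
Proof. by move=> t; exists [:: l] => //; econstructor; [exact: t | constructor]. Qed.

Lemma weak_cat s sigma s1 rho s' :
  weak s sigma s1 -> weak s1 rho s' -> weak s (sigma ++ rho) s'.
Proof.
move=> [u pu <-] [v pv <-]; exists (u ++ v); last by rewrite pmap_cat.
exact: fin_path_cat pu pv.
Qed.

Lemma weak_cat0 s sigma s1 s' :
  weak s sigma s1 -> weak s1 [::] s' -> weak s sigma s'.
Proof. by move=> h /(weak_cat h); rewrite cats0. Qed.

Lemma weak_ind_tail (P : seq Act -> state L -> Prop) sigma0 s rho s' :
  P sigma0 s ->
  (forall sigma s l s', P sigma s -> trans s l s' -> P (sigma ++ letters l) s') ->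
  weak s rho s' -> P (sigma0 ++ rho) s'.
Proof.
move=> + hP [u pu <-]; elim: pu sigma0 => {s s' u} [s|s l s1 u s' t _ IH] sigma0 h.
  by rewrite cats0.
have -> : pmap id (l :: u) = letters l ++ pmap id u by case: l t.
by rewrite catA; apply: IH; apply: hP h t.
Qed.

Lemma weak_split s sigma rho s' : weak s (sigma ++ rho) s' ->
  exists2 s1, weak s sigma s1 & weak s1 rho s'.
Proof.
move=> [u pu]; elim: pu sigma => {s u s'} [s|s l s1 u s' t pu IH] sigma.
  by case: sigma rho => [|//] [|//] _; exists s; exact: weak_refl.
case: sigma => [|a sigma] e.
  exists s; first exact: weak_refl.
  by exists (l :: u) => //; apply: FinPathCons t pu.
case: l t e => [b|] t /=.
  move=> [<- /IH[s2 h1 h2]]; exists s2 => //.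
  by rewrite -cat1s; apply: weak_cat h1; apply: weak_step t.
move=> /(IH (a :: sigma))[s2 h1 h2]; exists s2 => //.
exact: weak_cat (weak_step t) h1.
Qed.

Lemma weak0_ind (P : state L -> Prop) s s' :
  P s -> (forall s1 s2, P s1 -> trans s1 None s2 -> P s2) ->
  weak s [::] s' -> P s'.
Proof.
move=> h0 hP h.
have := weak_ind_tail (P := fun sg x => sg = [::] -> P x) (sigma0 := [::])
  (fun=> h0) _ h.
apply=> // -[|//] s1 [//|] s2 h1 t _; exact: hP (h1 _) t.
Qed.

Lemma weak1P s a s' : weak s [:: a] s' ->
  exists s1 s2, [/\ weak s [::] s1, trans s1 (Some a) s2 & weak s2 [::] s'].
Proof.
move=> [u pu]; elim: pu => {s u s'} // s [b|] s1 u s' t pu IH /=.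
  move=> [<- e]; exists s, s1; split=> //; first exact: weak_refl.
  by exists u.
move=> /IH[s2 [s3 [h1 h2 h3]]]; exists s2, s3; split=> //.
exact: weak_cat (weak_step t) h1.
Qed.

Lemma weak_alphabet s sigma a s' : weak s (sigma ++ [:: a]) s' -> alphabet L a.
Proof. by move=> /weak_split[s1 _ /weak1P[s2 [s3 [_ t _]]]]; exact: trans_alphabet t. Qed.

(* A state diverges iff it is not accessible for backward tau-steps, so
   well-founded induction replaces reasoning on infinite tau-paths. *)
Definition term s : Prop := Acc (fun s2 s1 => trans s1 None s2) s.

Lemma termN s : ~ term s -> exists2 s', trans s None s' & ~ term s'.
Proof.
move=> nt; apply: contrapT => h; apply: nt; constructor=> s' t.
by apply: contrapT => nt'; apply: h; exists s'.
Qed.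

Lemma divergesP s : diverges s <-> ~ term s.
Proof.
split=> [[rho <- h] t|nt].
  suff : forall x, term x -> forall n, rho n = x -> False by move=> /(_ _ t 0); apply.
  by move=> x; elim=> {}x _ IH n e; apply: (IH (rho n.+1)) (erefl _); rewrite -e.
have [f hf] : exists f : state L -> state L,
    forall x, ~ term x -> trans x None (f x) /\ ~ term (f x).
  have /choice[f hf] : forall x, exists y, ~ term x -> trans x None y /\ ~ term y.
    move=> x; case: (pselect (term x)) => [t|/termN[y]]; first by exists x.
    by exists y.
  by exists f.
exists (fun n => iter n f s) => // i /=.
suff /hf[] : ~ term (iter i f s) by [].
by elim: i => //= i /hf[].
Qed.

Lemma weak0_cases s s' : weak s [::] s' ->
  s = s' \/ exists2 s1, trans s None s1 & weak s1 [::] s'.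
Proof.
move=> [u pu]; case: pu => {s s' u} [s|s [//|] s1 u s' t pu] e; first by left.
by right; exists s1 => //; exists u.
Qed.

(** No terminating state silently reaches an [x p], by well-founded induction: either a silent step
    leads on, or the state is [x p] itself and the tau-step of its segment does. *)
Lemma diverges_seq (x : nat -> state L) :
  (forall p, exists y z, [/\ weak (x p) [::] y, trans y None z & weak z [::] (x p.+1)]) ->
  diverges (x 0).
Proof.
move=> hx; apply/divergesP.
suff H s : term s -> forall p, ~ weak s [::] (x p).
  by move=> /H/(_ 0); apply; exact: weak_refl.
elim=> {}s _ IH p /weak0_cases[e|[s1 t h]]; last exact: IH t p h.
subst s; have [y [z [/weak0_cases[e|[s1 t1 h1]] t h2]]] := hx p.
  by rewrite -e in t; exact: IH t p.+1 h2.
exact: IH t1 p.+1 (weak_cat h1 (weak_cat (weak_step t) h2)).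
Qed.

Definition stable s : Prop := forall s', ~ trans s None s'.

Lemma term_stable s : term s -> exists2 s', weak s [::] s' & stable s'.
Proof.
elim=> {}s _ IH; case: (pselect (stable s)) => [st|].
  by exists s => //; exact: weak_refl.
move=> /existsNP[s1 /contrapT t]; have [s' h st] := IH _ t.
by exists s' => //; exact: weak_cat (weak_step t) h.
Qed.

Definition Tr : set (seq Act) :=
  [set sigma | exists s, weak (initial L) sigma s].

(** A terminating state silently reaches a stable one, which refuses the empty set. Hence [Sf] and
    [Div] determine the traces. *)
Lemma TrE sigma : Tr sigma <-> Div L sigma \/ Sf L (sigma, set0).
Proof.
split=> [[s h]|[[s h _]|[_ [s h _]]]]; try by exists s.
case: (pselect (term s)) => [/term_stable[s' h' st]|/divergesP]; last by left; exists s.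
right; split=> //=; exists s'; first exact: weak_cat0 h h'.
by move=> l [[a []]|->] //; exact: st.
Qed.

(** With one state per visible letter, infinite traces need no bookkeeping of the tau-steps in
    between. *)
Definition run (xi : nat -> Act) (r : nat -> state L) : Prop :=
  forall n, weak (r n) [:: xi n] (r n.+1).

Lemma run_of_word (x : nat -> state L) w xi :
  (forall p, weak (x p) (letters (w p)) (x p.+1)) -> inf_visible w xi ->
  exists2 r, r 0 = x 0 & run xi r.
Proof.
move=> hx /inf_visibleP hw.
have seg p p' : p <= p' -> exists2 u, vis w p' = vis w p ++ u & weak (x p) u (x p').
  move=> /subnKC <-; elim: (p' - p) => [|n [u e h]].
    by exists [::]; rewrite ?cats0 ?addn0 //; exact: weak_refl.
  exists (u ++ letters (w (p + n))); rewrite addnS; first by rewrite visS e catA.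
  exact: weak_cat h (hx _).
have [k hk] := choice hw.
(* [k 0] may lie past leading tau-steps, but the run has to start at [x 0]. *)
pose k' n := if n is 0 then 0 else k n.
have hk' n : vis w (k' n) = mkseq xi n by case: n => //= n; rewrite hk.
exists (x \o k') => // n /=.
have /ltnW/seg[u] : k' n < k' n.+1.
  by apply: (@leq_of_size_vis _ w); rewrite !hk' !size_mkseq.
by rewrite !hk' mkseqS -cats1 => /(congr1 (drop n)); rewrite !drop_size_cat ?size_mkseq// => ->.
Qed.

Lemma InfP xi : Inf L xi <-> exists2 r, r 0 = initial L & run xi r.
Proof.
split=> [[w [x <- hx] hw]|[r r0 hr]].
  by apply: run_of_word hw => p; exact: weak_step.
(* A configuration [(n, s, u)] is a state [s] together with a pending path [u]
   to [r n.+1] that still has to output [xi n]. *)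
pose good (c : nat * state L * seq (option Act)) :=
  fin_path c.1.2 c.2 (r c.1.1.+1) /\ pmap id c.2 = [:: xi c.1.1].
(* A step outputs the pending letter or removes a tau from the pending path; the decreasing size
   forces every letter to come out. *)
pose succ (c c' : nat * state L * seq (option Act)) :=
  (trans c.1.2 (Some (xi c.1.1)) c'.1.2 /\ c'.1.1 = c.1.1.+1) \/
  [/\ trans c.1.2 None c'.1.2, c'.1.1 = c.1.1 & size c'.2 < size c.2].
have ex_succ c : exists c', good c -> good c' /\ succ c c'.
  case: (pselect (good c)) => [|ng]; last by exists c.
  case: c => -[n s] u [] /= pu; move e: (r n.+1) pu => s' pu.
  case: pu e => // {u s'} {}s [b|] s1 u s' t pu e /=; last first.
    by move=> eu; exists (n, s1, u) => _; split; [split; rewrite /= ?e | right].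
  move=> [eb eu]; have [v pv ev] := hr n.+1.
  exists (n.+1, s1, u ++ v) => _; split; last by left; rewrite /= -eb.
  split; last by rewrite /= pmap_cat eu ev.
  by apply: fin_path_cat pu _; rewrite -e.
have [f hf] := choice ex_succ.
have [u0 pu0 eu0] := hr 0.
pose C i := iter i f (0, r 0, u0).
have gC i : good (C i) by elim: i => [|i /hf[]].
have sC i : succ (C i) (C i.+1) by have [] := hf _ (gC i).
pose w i := if (C i.+1).1.1 == (C i).1.1 then None else Some (xi (C i).1.1).
have wE i : trans (C i).1.2 (w i) (C i.+1).1.2.
  rewrite /w; case: (sC i) => [[t ->]|[t -> _]]; last by rewrite eqxx.
  by rewrite gtn_eqF.
exists w; first by exists (fun i => (C i).1.2).
have visE i : vis w i = mkseq xi (C i).1.1.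
  elim: i => // i IHi; rewrite visS IHi /w.
  case: (sC i) => [[_ ->]|[_ -> _]]; last by rewrite eqxx cats0.
  by rewrite gtn_eqF// mkseqS -cats1.
apply/inf_visibleP => n; suff [i ei] : exists i, (C i).1.1 = n by exists i; rewrite visE ei.
elim: n => [|n [i]]; first by exists 0.
have [m] := ubnP (size (C i).2); elim: m i => // m IHm i szm ei.
case: (sC i) => [[_ e]|[_ e sz]]; first by exists i.+1; rewrite e ei.
by apply: (IHm i.+1); [exact: leq_trans sz _ | rewrite e].
Qed.

(** Choice needs a step function working from the initial state on, so [Q] also admits states still
    on their way along [xi] to a state satisfying [P]. *)
Lemma Inf_eventually (P : nat -> state L -> Prop) xi N s1 :
  weak (initial L) (mkseq xi N) s1 -> P N s1 ->
  (forall n s, P n s -> exists2 s', weak s [:: xi n] s' & P n.+1 s') ->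
  Inf L xi.
Proof.
move=> h1 hN hP.
pose Q n s := P n s \/ exists m s', [/\ weak s [seq xi i | i <- iota n m] s' & P (n + m) s'].
have hQ n s : exists s', Q n s -> weak s [:: xi n] s' /\ Q n.+1 s'.
  case: (pselect (Q n s)) => [|nq]; last by exists s.
  suff : Q n s -> exists s', weak s [:: xi n] s' /\ Q n.+1 s' by move=> h /h[s' ?]; exists s'.
  have HP s2 : P n s2 -> exists s', weak s2 [:: xi n] s' /\ Q n.+1 s'.
    by move=> /hP[s' ? ?]; exists s'; split => //; left.
  move=> [/HP//|[[|m] [s' [h hm]]]].
    have [s2 [h2 q2]] : exists s2, weak s' [:: xi n] s2 /\ Q n.+1 s2.
      by apply: HP; rewrite -(addn0 n).
    by exists s2; split => //; exact: (weak_cat h h2).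
  move: h => /(weak_split (sigma := [:: xi n])) [s2 h2 h3].
  by exists s2; split => //; right; exists m, s'; rewrite addSnnS.
have [f hf] := choice (fun ns : nat * state L => hQ ns.1 ns.2).
pose r := fix r n := if n is n'.+1 then f (n', r n') else initial L.
have qr n : Q n (r n).
  by elim: n => [|n /(hf (_, _))[]//]; right; exists N, s1.
by apply/InfP; exists r => // n; have [] := hf (n, r n) (qr n).
Qed.

Lemma Inf_alphabet xi i : Inf L xi -> alphabet L (xi i).
Proof. by move=> /InfP[r _ hr]; exact: (@weak_alphabet _ [::] _ _ (hr i)). Qed.

End Weak.

Lemma weak_map (Act : Type) (L L' : LTS Act) (f : state L -> state L') s sigma s' :
  (forall s l s', trans s l s' -> weak (f s) (letters l) (f s')) ->
  weak s sigma s' -> weak (f s) sigma (f s').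
Proof.
move=> hf h.
have := weak_ind_tail (P := fun sg x => weak (f s) sg (f x)) (weak_refl (f s)) _ h.
by apply=> sg s1 l s2 h1 /hf; exact: weak_cat h1.
Qed.

Lemma diverges_map (Act : Type) (L L' : LTS Act) (f : state L -> state L') s :
  (forall s s', trans s None s' -> trans (f s) None (f s')) ->
  diverges s -> diverges (f s).
Proof. by move=> hf [x <- h]; exists (f \o x) => // i; exact/hf/h. Qed.

(** * Driving a system by a controller *)

Definition relabel_trans (A B : Type) (g : A -> B) (L : LTS A)
    (s : state L) (l : option B) (s' : state L) : Prop :=
  exists2 l0, trans s l0 s' & l = omap g l0.

Lemma relabel_alphabet (A B : Type) (g : A -> B) (L : LTS A) s b s' :
  @relabel_trans A B g L s (Some b) s' -> (g @` alphabet L) b.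
Proof. by move=> [[a|//] t [->]]; exists a => //; exact: trans_alphabet t. Qed.

(** [rename] keeps the type of actions, while controllers have labels in [Act + nat] that must be
    brought into [Act]. *)
Definition relabel (A B : Type) (g : A -> B) (L : LTS A) : LTS B :=
  MkLTS (initial L) (@relabel_alphabet A B g L).

Lemma par_trans_inv (Act : Type) (L1 L2 : LTS Act) q t l q' t' :
  @par_trans Act L1 L2 (q, t) l (q', t') ->
  [\/ [/\ shared L1 L2 l, trans q l q' & trans t l t'],
      [/\ ~ shared L1 L2 l, trans q l q' & t' = t] |
      [/\ ~ shared L1 L2 l, q' = q & trans t l t']].
Proof.
by move=> p; inversion p; subst; [constructor 1|constructor 2|constructor 3].
Qed.

Lemma shared_tau (Act : Type) (L1 L2 : LTS Act) : ~ shared L1 L2 None.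
Proof. by case. Qed.

Lemma shared_some (Act : Type) (L1 L2 : LTS Act) a :
  shared L1 L2 (Some a) <-> (alphabet L1 a /\ alphabet L2 a).
Proof. by split=> [[b h [<-]]|h] //; exists a. Qed.

Section Drive.
Variables (Act : Type) (g : Act + nat -> Act).
Hypothesis g_inj : injective g.
Implicit Types (K : LTS Act) (T : LTS (Act + nat)).

Definition cue (i : nat) : Act := g (inr i).

(* The controller [T] performs visible actions [inl a] on its own and steps [K]
   along [inr i], invisibly to the outside. *)
Definition drive K T : LTS Act :=
  rename (Defs.hide (par K (relabel g T)) (range cue))
    [set x | x.1 = g (inl x.2)].

Lemma drive_cong R K K' T : congruence R -> R K K' ->
  R (drive K T) (drive K' T).
Proof.
move=> cR KK'; apply: (cong_rename cR); apply: (cong_hide cR).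
exact: (cong_parl cR).
Qed.

Variables (K : LTS Act) (T : LTS (Act + nat)).
Hypothesis alphabetK : alphabet K = range cue.
Hypothesis alphabetT : forall i, alphabet T (inr i).

Lemma drive_alphabet : alphabet (drive K T) = [set a | alphabet T (inl a)].
Proof.
apply/seteqP; split=> a /=.
  move=> [b [+ nb]]; rewrite alphabetK => -[//|[[a'|i] h eb]]; subst b; last by case: nb; exists i.
  by move=> [/= /g_inj [<-]|[_ /= []]] //; exists a'.
move=> h; exists (g (inl a)); last by left.
by split; [right; exists (inl a) | move=> [i _ /g_inj]].
Qed.

Lemma shared_cue i : shared K (relabel g T) (Some (cue i)).
Proof. by apply/shared_some; split; [rewrite alphabetK; exists i | exists (inr i)]. Qed.

Lemma shared_out a : ~ shared K (relabel g T) (Some (g (inl a))).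
Proof. by move=> /shared_some[]; rewrite alphabetK => -[i _ /g_inj]. Qed.

(** All actions of [K] are cues, hence shared and hidden, so only the controller acts visibly. *)
Lemma drive_vis (q q' : state K) (t t' : state T) a :
  @trans _ (drive K T) (q, t) (Some a) (q', t') <->
  q' = q /\ trans t (Some (inl a)) t'.
Proof.
split=> [[[b|//] [p nb] ab]|[-> h]].
  (* Were [b] left unrenamed, it would be no [g (inl _)], hence a cue, and cues are hidden. *)
  have eb : b = g (inl a).
    case: ab => [//|[ba nv]]; subst b; case: (par_alphabet p) => [|[[a'|i] _ e]].
    - by rewrite alphabetK => -[i _ e]; case: nb; exists i.
    - by case: nv; exists a'.
    - by case: nb; exists i.
  subst b; case: (par_trans_inv p) => [[/shared_out//]|[_ tq _]|[_ -> [l t1 e]]].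
    by move: (trans_alphabet tq); rewrite alphabetK => -[i _ /g_inj].
  by case: l t1 e => // d t1 [/g_inj e]; subst d.
exists (Some (g (inl a))); last by left.
split; last by move=> [i _ /g_inj].
by apply: ParRight; [exact: shared_out | exists (Some (inl a))].
Qed.

Lemma drive_tau (q q' : state K) (t t' : state T) :
  @trans _ (drive K T) (q, t) None (q', t') <->
  [\/ trans q None q' /\ t' = t, q' = q /\ trans t None t' |
    exists i, trans q (Some (cue i)) q' /\ trans t (Some (inr i)) t'].
Proof.
split=> [[[//|] [p|[b [i _ <-] p]] _]|].
- case: (par_trans_inv p) => [[/shared_tau//]|[_ h ->]|[_ -> [[//|] h _]]].
    by constructor 1.
  by constructor 2.
- constructor 3; exists i.
  case: (par_trans_inv p) => [[_ h [[d|//] h' [e]]]|[]|[]]; try by have := shared_cue i.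
  by split=> //; move: h'; rewrite -(g_inj e).
move=> h; exists None => //; case: h => [[h ->]|[-> h]|[i [h h']]].
- by left; apply: ParLeft => //; exact: shared_tau.
- by left; apply: ParRight; [exact: shared_tau | exists None].
- right; exists (cue i); first by exists i.
  by apply: ParSync => //; [exact: shared_cue | exists (Some (inr i))].
Qed.

End Drive.

(** * Encoding an infinite word by cues *)

Section Track.
Variables (Act : Type) (g : Act + nat -> Act).
Hypothesis g_inj : injective g.
Variable xi : nat -> Act.

Notation cue := (cue g).

(* The i-th letter of [xi] becomes the cue [i.+1] of its own, whatever else
   [xi] repeats; [cue 0] comes first to make the initial state stable. *)
Definition track_rel : set (Act * Act) :=
  [set x | (exists i, x = (xi i, cue i.+1)) \/ x.2 = cue 0].

Definition track (L : LTS Act) : LTS Act :=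
  act_prefix (cue 0) (rename L track_rel).

Lemma track_cong R L L' : congruence R -> R L L' -> R (track L) (track L').
Proof. by move=> cR LL'; apply: (cong_act_prefix cR); exact: (cong_rename cR). Qed.

Variable L : LTS Act.
Hypothesis xiL : forall i, alphabet L (xi i).

(** Every action may become [cue 0], so all lie in the domain of [track_rel] and the identity clause
    of [renames] never applies. *)
Lemma renames_track a b : renames track_rel a b <-> track_rel (a, b).
Proof.
split=> [[//|[_ h]]|]; last by left.
by case: h; exists (cue 0); right.
Qed.

Lemma cue_inj : injective cue.
Proof. by move=> i j /g_inj[]. Qed.

Lemma track_alphabet : alphabet (track L) = range cue.
Proof.
apply/seteqP; split=> b /=.
  move=> [[a _ /renames_track[[i [_ ->]]|/= ->]]|->]; first by exists i.+1.
    by exists 0.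
  by exists 0.
move=> [[|i] _ <-]; first by right.
by left; exists (xi i) => //; apply/renames_track; left; exists i.
Qed.

Lemma track_init l s : @trans _ (track L) None l s ->
  l = Some (cue 0) /\ s = Some (initial L).
Proof. by move=> t; inversion t. Qed.

Lemma track_step (q : state L) l s : @trans _ (track L) (Some q) l s ->
  exists2 q', s = Some q' & @trans _ (rename L track_rel) q l q'.
Proof. by move=> t; inversion t; subst; eexists. Qed.

Lemma track_tau (q : state L) s : @trans _ (track L) (Some q) None s <->
  exists2 q', s = Some q' & trans q None q'.
Proof.
split=> [t|[q' -> t]].
  by have [q' -> [[//|] t' _]] := track_step t; exists q'.
by apply: (@ActPrefixRest _ _ (rename L track_rel)); exists None.
Qed.

Lemma track_cue (q : state L) i s : @trans _ (track L) (Some q) (Some (cue i.+1)) s <->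
  exists2 q', s = Some q' & trans q (Some (xi i)) q'.
Proof.
split=> [t|[q' -> t]].
  have [q' -> [[b|//] t' /renames_track[[j [eb /cue_inj[ei]]]|/cue_inj//]]] := track_step t.
  by exists q' => //; rewrite ei -eb.
apply: (@ActPrefixRest _ _ (rename L track_rel)); exists (Some (xi i)) => //.
by apply/renames_track; left; exists i.
Qed.

Lemma track_weak0 (q : state L) s : @weak _ (track L) (Some q) [::] s ->
  exists2 q', s = Some q' & weak q [::] q'.
Proof.
apply: (@weak0_ind _ (track L) (fun s => exists2 q', s = Some q' & weak q [::] q')).
  by exists q => //; exact: weak_refl.
move=> s1 s2 [q1 -> h] /track_tau[q2 -> t]; exists q2 => //.
exact: weak_cat h (weak_step t).
Qed.

Lemma track_weak1 (q : state L) i s : @weak _ (track L) (Some q) [:: cue i.+1] s ->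
  exists2 q', s = Some q' & weak q [:: xi i] q'.
Proof.
move=> h; have [s1 [s2 [/track_weak0[q1 e1 h1] t h3]]] := weak1P h; subst s1.
have [q2 e2 t2] := (track_cue _ _ _).1 t; subst s2.
have [q3 -> {}h3] := track_weak0 h3.
exists q3 => //; exact: weak_cat h1 (weak_cat (weak_step t2) h3).
Qed.

Lemma track_weak_init0 s : @weak _ (track L) None [::] s -> s = None.
Proof.
apply: (@weak0_ind _ (track L) (fun s => s = None)) => // s1 s2 -> /track_init[].
by [].
Qed.

Lemma track_weak_init1 s : @weak _ (track L) None [:: cue 0] s ->
  exists2 q', s = Some q' & weak (initial L) [::] q'.
Proof.
move=> h; have [s1 [s2 [h1 t h2]]] := weak1P h.
move: t h2; rewrite (track_weak_init0 h1) => /track_init[_ ->].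
exact: track_weak0.
Qed.

Lemma track_weak i s : weak (initial (track L)) (mkseq cue i.+1) s ->
  exists2 q, s = Some q & weak (initial L) (mkseq xi i) q.
Proof.
elim: i s => [|i IH] s; first exact: track_weak_init1.
rewrite mkseqS -cats1 => /weak_split[s1 /IH[q1 -> h1] /track_weak1[q2 -> h2]].
by exists q2 => //; rewrite mkseqS -cats1; exact: weak_cat h1 h2.
Qed.

Lemma track_diverges (q : state L) : @diverges _ (track L) (Some q) -> diverges q.
Proof.
move=> /divergesP nt; apply/divergesP => t; apply: nt.
elim: t => {}q _ IH; constructor=> s /track_tau[q' -> /IH].
exact.
Qed.

Lemma track_Div i : Div (track L) (mkseq cue i.+1) -> Div L (mkseq xi i).
Proof. by move=> [s /track_weak[q -> h] /track_diverges d]; exists q. Qed.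

(** Initially only [cue 0] is possible. This yields [~ B 0] for the simulator, which thus starts
    while the driven system terminates. *)
Lemma track_Div0 : ~ Div (track L) [::].
Proof.
move=> [s h /divergesP]; rewrite (track_weak_init0 h); apply.
by constructor=> s' /track_init[].
Qed.

Lemma track_Inf : Inf (track L) cue <-> Inf L xi.
Proof.
split=> /InfP[r r0 hr]; apply/InfP.
  have hr0 := hr 0; rewrite r0 in hr0.
  have [q0 e0 h0] := track_weak_init1 hr0.
  have /choice[q hq] : forall n, exists q, r n.+1 = Some q.
    elim=> [|n [q e]]; first by exists q0.
    by have := hr n.+1; rewrite e => /track_weak1[q' e' _]; exists q'.
  have hq' n : @weak _ L (q n) [:: xi n] (q n.+1).
    by have := hr n.+1; rewrite !hq => /track_weak1[q1 [->]].
  (* The silent moves made after [cue 0] are merged into the first letter of [xi]. *)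
  exists (fun n => if n is 0 then initial L else q n) => // -[|n]; last exact: hq'.
  have e : q0 = q 0 by move: e0; rewrite hq => -[].
  by rewrite e in h0; exact: (weak_cat h0 (hq' 0)).
exists (fun n => if n is n'.+1 then Some (r n') else None) => // -[|n].
  by rewrite r0; apply: (@weak_step _ (track L) _ (Some _)); exact: ActPrefixFirst.
have [s1 [s2 [h1 t h2]]] := weak1P (hr n).
have some (s s' : state L) : weak s [::] s' -> @weak _ (track L) (Some s) [::] (Some s').
  apply: (@weak0_ind _ L (fun s' => @weak _ (track L) (Some s) [::] (Some s'))).
    exact: weak_refl.
  move=> y z h tau; apply: weak_cat h (@weak_step _ (track L) _ None _ _).
  by apply/track_tau; exists z.
have tK : @trans _ (track L) (Some s1) (Some (cue n.+1)) (Some s2).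
  by apply/track_cue; exists s2.
exact: weak_cat (some _ _ h1) (weak_cat (weak_step tK) (some _ _ h2)).
Qed.

End Track.

(** * Preservation of [eanI] *)

Section EanI.
Variables (Act : Type) (g : Act + nat -> Act).
Hypothesis g_inj : injective g.
Variables (n : nat) (a : Act).

Notation cue := (cue g).

(* [count_trans] follows the word [inr 0 .. inr n.-1, inl a, inr n, ..]. *)
Definition count_trans (p : nat) (l : option (Act + nat)) (p' : nat) : Prop :=
  p' = p.+1 /\
  l = Some (if p == n then inl a else inr (if p <= n then p else p.-1)).

Lemma count_alphabet p l p' : count_trans p (Some l) p' -> setT l.
Proof. by []. Qed.

Definition counter : LTS (Act + nat) := MkLTS 0 count_alphabet.

Lemma counter_cue i : alphabet counter (inr i).
Proof. by []. Qed.

Variable K : LTS Act.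
Hypothesis alphabetK : alphabet K = range cue.

Let D := drive g K counter.

(** The output [a] takes up one position of the counter, so past it [K] has performed only [p.-1]
    cues. *)
Lemma counter_reach sigma q p :
  @weak _ D (initial K, 0) sigma (q, p) ->
  if p <= n then sigma = [::] /\ weak (initial K) (mkseq cue p) q
  else sigma = [:: a] /\ weak (initial K) (mkseq cue p.-1) q.
Proof.
pose P sg (x : state D) := if x.2 <= n then sg = [::] /\ weak (initial K) (mkseq cue x.2) x.1
  else sg = [:: a] /\ weak (initial K) (mkseq cue x.2.-1) x.1.
have P0 : P [::] (initial K, 0) by split=> //; exact: weak_refl.
apply: (@weak_ind_tail _ D P [::] (initial K, 0) sigma (q, p) P0).
move=> {P0 q p sigma} sg [q p] l [q' p'].
rewrite /P /=; case: l => [b|]; rewrite /letters /=.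
  move=> h /(drive_vis g_inj alphabetK)[-> [-> []]].
  case: eqP => // pn [->]; move: h; rewrite pn leqnn ltnn => -[-> h] //.
move=> + /(drive_tau g_inj alphabetK counter_cue) h; rewrite cats0.
case: h => [[t ->]|[_ []//]|[i [t [-> []]]]].
  by case: ifP => _ [-> h]; split=> //; exact: weak_cat0 h (weak_step t).
case: (ltngtP p n) => // pn [ei]; subst i.
  by move=> [-> h]; split=> //; rewrite mkseqS -cats1; exact: weak_cat h (weak_step t).
move=> [-> h]; split=> //; case: p pn h t => // p pn h t.
by rewrite mkseqS -cats1; exact: weak_cat h (weak_step t).
Qed.

Lemma counter_tau (q q' : state K) p p' : @trans _ D (q, p) None (q', p') <->
  trans q None q' /\ p' = p \/
  [/\ p' = p.+1, p != n & trans q (Some (cue (if p <= n then p else p.-1))) q'].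
Proof.
split=> [/(drive_tau g_inj alphabetK counter_cue)[]|].
- by left.
- by move=> [_ []].
- by move=> [i [t [-> [e]]]]; right; move: e; case: eqP => // _ [<-].
move=> h; apply/(drive_tau g_inj alphabetK counter_cue).
case: h => [h|[-> pn t]]; first by constructor 1.
constructor 3; exists (if p <= n then p else p.-1); split=> //.
by split=> //; rewrite (negPf pn).
Qed.

Lemma counter_weak0 (q q' : state K) p : weak q [::] q' -> @weak _ D (q, p) [::] (q', p).
Proof.
apply: (@weak0_ind _ K (fun q' => @weak _ D (q, p) [::] (q', p))); first exact: weak_refl.
move=> q1 q2 h t; apply: weak_cat h (@weak_step _ D _ None _ _).
by apply/counter_tau; left.
Qed.

Lemma counter_Div_of_Inf : Inf K cue -> Div D [:: a].
Proof.
move=> /InfP[r r0 hr].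
(* The number of cues among the first [p] labels of the counter. *)
pose m p := if p <= n then p else p.-1.
have tick p : p != n -> exists y z, [/\ @weak _ D (r (m p), p) [::] y,
    trans y None z & weak z [::] (r (m p.+1), p.+1)].
  move=> pn; have [s1 [s2 [h1 t h2]]] := weak1P (hr (m p)).
  exists (s1, p), (s2, p.+1); split; first exact: counter_weak0.
    by apply/counter_tau; right.
  apply: counter_weak0; suff -> : m p.+1 = (m p).+1 by [].
  by move: pn; rewrite /m; clear; case: ifP; case: ifP; lia.
have upto p : p <= n -> @weak _ D (initial D) [::] (r (m p), p).
  elim: p => [_|p IH pn]; first by rewrite /m leq0n r0; exact: weak_refl.
  have [|y [z [h1 t h2]]] := tick p; first by rewrite ltn_eqF.
  exact: weak_cat (IH (ltnW pn)) (weak_cat h1 (weak_cat (weak_step t) h2)).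
have mn : m n.+1 = m n by rewrite /m ltnn leqnn.
exists (r (m n.+1), n.+1).
  have t : @trans _ D (r (m n), n) (Some a) (r (m n.+1), n.+1).
    by apply/(drive_vis g_inj alphabetK); rewrite mn; split=> //; split=> //; rewrite eqxx.
  exact: weak_cat (upto n (leqnn n)) (weak_step t).
apply: (@diverges_seq _ D (fun i => (r (m (i + n.+1)), i + n.+1))) => i.
by apply: tick; lia.
Qed.

(** From [n] cues on, [K] terminates between cues, so a divergence after [a] must perform all
    further cues. *)
Lemma counter_Inf_of_Div : Div D [:: a] ->
  (forall i, n <= i -> ~ Div K (mkseq cue i)) -> Inf K cue.
Proof.
move=> [[q p] /counter_reach hp /divergesP nt] nD; move: hp nt.
case: ifP => [_ [//]|/negbT]; rewrite -ltnNge; case: p => // p np [_ h] nt.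
(* After [m] cues the counter is at [m.+1], since [a] has been output as well. *)
pose P m q := [/\ weak (initial K) (mkseq cue m) q, n <= m & ~ @term _ D (q, m.+1)].
apply: (@Inf_eventually _ _ P _ _ _ h); first by split.
move=> {q p np nt h} m q [h nm nt].
have tq : term q by apply: contrapT => /divergesP d; apply: (nD m) => //; exists q.
elim: tq h nt => {}q _ IH h /termN[[q' p'] /counter_tau[[t ->]|[-> _]]].
  move=> nt; have [||q2 h2 H2] := IH _ t; [exact: weak_cat0 h (weak_step t) | exact: nt |].
  by exists q2 => //; exact: weak_cat (weak_step t) h2.
rewrite leqNgt ltnS nm /= => t nt; exists q'; first exact: (weak_step t).
split=> //; last exact: leqW.
by rewrite mkseqS -cats1; exact: weak_cat h (weak_step t).
Qed.

End EanI.

Lemma eanI_preserved (Act : Type) (g : Act + nat -> Act) (g_inj : injective g)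
    (R : LTS Act -> LTS Act -> Prop) (cR : congruence R)
    (R_alphabet : preserves (@alphabet Act) R) (R_Div : preserves (@Div Act) R) :
  preserves (@eanI Act) R.
Proof.
suff H L L' : R L L' -> eanI L `<=` eanI L'.
  move=> L L' RL; apply/seteqP; split; first exact: H.
  by apply: H; have := cong_equiv cR => -[_ sym _]; exact: sym.
move=> RL xi [ixi [n nD]]; have eD := R_Div _ _ RL.
split; last by exists n => i /nD; rewrite eD.
have xiL i := Inf_alphabet i ixi.
have xiL' i : alphabet L' (xi i) by rewrite -(R_alphabet _ _ RL).
apply/(track_Inf g_inj xi L').
have RK : R (track g xi L) (track g xi L') by exact: track_cong.
have := R_Div _ _ (drive_cong g (counter n.+1 (xi 0)) cR RK) => eDD.
(* The index is [n.+1] because [track] puts [cue 0] in front; [xi 0] merely supplies some visible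
   action. *)
apply: (@counter_Inf_of_Div _ _ g_inj n.+1 (xi 0)).
- exact: track_alphabet.
- rewrite -eDD; apply: counter_Div_of_Inf => //; first exact: track_alphabet.
  exact/track_Inf.
by move=> [//|i] ni /(track_Div g_inj); rewrite -eD; exact: nD.
Qed.

(** * Tours with visible and hidden steps *)

Section Tours.
Variable Act : Type.
Implicit Types (w : nat -> option Act) (T D : set (seq Act)) (B : set nat).

Definition skips w p : nat := count (fun l => ~~ isSome l) (mkseq w p).

Lemma skipsS w p : skips w p.+1 = skips w p + ~~ isSome (w p).
Proof. by rewrite /skips mkseqS -cats1 count_cat /= addn0. Qed.

Lemma leq_skips w p p' : p <= p' -> skips w p <= skips w p'.
Proof.
move=> /subnKC <-; elim: (p' - p) => [|k IH]; first by rewrite addn0.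
by rewrite addnS skipsS; exact: leq_trans IH (leq_addr _ _).
Qed.

(* A tour interleaves infinitely many visible letters with infinitely many
   hidden steps, written [None]; [B] is the set of numbers of hidden steps after
   which the driven system may diverge. *)
Definition tour T D B w : Prop :=
  [/\ forall p, T (vis w p),
      forall p, B (skips w p) -> D (vis w p),
      forall n, exists p, n <= size (vis w p) &
      forall n, exists p, n <= skips w p].

(** This bounds the hidden steps made at one trace, so that tours cannot create new divergences. *)
Lemma tour_next T D B w p : tour T D B w -> exists2 k, p <= k & isSome (w k).
Proof.
move=> [_ _ /(_ (size (vis w p)).+1)[p' hp'] _]; apply: contrapT => h.
have pp' : p <= p' by exact: ltnW (leq_of_size_vis hp').
move: hp'; rewrite (vis_const pp') ?ltnn// => j /andP[pj _].
by case e: (w j) => //; case: h; exists j; rewrite ?e.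
Qed.

(** A greedy schedule works: after a letter leading to a prefix in [D], make one hidden step, then
    more while [B] holds; otherwise append a letter. Letters are thus appended only at counts
    outside [B]. *)
Lemma tour_exists T D B (xi : nat -> Act) :
  (forall n, T (mkseq xi n)) ->
  (forall n, exists2 i, n <= i & D (mkseq xi i)) ->
  ~ B 0 -> (forall n, exists2 i, n <= i & ~ B i) ->
  exists2 w, tour T D B w & inf_visible w xi.
Proof.
move=> hT hD nB0 hB.
(* [(j, d, f)]: [j] letters and [d] hidden steps so far; [f] tells whether the
   last step was hidden. *)
pose skip (c : nat * nat * bool) :=
  `[< D (mkseq xi c.1.1) >] && (~~ c.2 || `[< B c.1.2 >]).
pose next c := if skip c then (c.1.1, c.1.2.+1, true) else (c.1.1.+1, c.1.2, false).
pose C p := iter p next (0, 0, false).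
have CS p : C p.+1 = next (C p) by [].
pose w p := if skip (C p) then None else Some (xi (C p).1.1).
have visE p : vis w p = mkseq xi (C p).1.1.
  elim: p => // p IH; rewrite visS IH CS /w /next.
  by case: ifP => _ /=; rewrite ?cats0// mkseqS cats1.
have skipsE p : skips w p = (C p).1.2.
  by elim: p => // p IH; rewrite skipsS IH CS /w /next; case: ifP => _ /=; rewrite ?addn0 ?addn1.
have inv p : B (C p).1.2 -> D (mkseq xi (C p).1.1).
  elim: p => // p IH; rewrite CS /next; case: ifP => /=.
    by move=> /andP[/asboolP].
  move=> /negbT; rewrite negb_and negb_or => /orP[/asboolPn nD /IH //|].
  by move=> /andP[_ /asboolPn].
have adv_vis p : exists p', (C p').1.1 = (C p).1.1.+1.
  have [i di nBi] := hB (C p).1.2.+1.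
  (* [~~ (C q).2] leaves room for the hidden step that follows a letter at a prefix in [D] even if
     [B] fails. *)
  suff H k q : (C q).1.2 + ~~ (C q).2 <= i -> i - (C q).1.2 < k ->
      exists p', (C p').1.1 = (C q).1.1.+1.
    by apply: (H _ p _ (ltnSn _)); case: (C p).2; lia.
  elim: k q => // k IH q le_i lt_k; case e: (skip (C q)); last first.
    by exists q.+1; rewrite CS /next e.
  have lt_i : (C q).1.2 < i.
    case f : (C q).2 le_i => le_i; last by lia.
    suff : (C q).1.2 <> i by lia.
    by move=> di'; move: e; rewrite /skip f di' => /andP[_ /asboolP].
  have [||p'] := IH q.+1; rewrite CS /next e //=; first by lia.
    by lia.
  by exists p'.
have adv_skip p : exists p', (C p').1.2 = (C p).1.2.+1.
  have [i ji Di] := hD (C p).1.1.+1.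
  (* Dually, [(C q).2] leaves room for a letter due right after a hidden step even at a prefix in
     [D]. *)
  suff H k q : (C q).1.1 + (C q).2 <= i -> i - (C q).1.1 < k ->
      exists p', (C p').1.2 = (C q).1.2.+1.
    by apply: (H _ p _ (ltnSn _)); case: (C p).2; lia.
  elim: k q => // k IH q le_i lt_k; case e: (skip (C q)).
    by exists q.+1; rewrite CS /next e.
  have lt_i : (C q).1.1 < i.
    suff : (C q).1.1 <> i \/ (C q).2 by case: (C q).2 le_i; lia.
    case f : (C q).2; [by right|left=> ji'].
    by move: e; rewrite /skip ji' f; move/asboolP: Di => ->.
  have [||p'] := IH q.+1; rewrite CS /next e //=; first by lia.
    by lia.
  by exists p'.
have all_vis n : exists p, (C p).1.1 = n.
  by elim: n => [|n [p <-]]; [exists 0 | exact: adv_vis].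
exists w; last by apply/inf_visibleP => n; have [p <-] := all_vis n; exists p.
split=> [p|p|n|n].
- by rewrite visE.
- by rewrite skipsE visE; exact: inv.
- by have [p <-] := all_vis n; exists p; rewrite visE size_mkseq.
have [p <-] : exists p, (C p).1.2 = n.
  by elim: n => [|n [p <-]]; [exists 0 | exact: adv_skip].
by exists p; rewrite skipsE.
Qed.

End Tours.

(** * The simulating controller *)

Section Simulation.
Variables (Act : Type) (g : Act + nat -> Act).
Hypothesis g_inj : injective g.
Variables (M : LTS Act) (B : set nat).

Notation cue := (cue g).
Let touring := tour (Tr M) (Div M) B.

Inductive sim_state : Type :=
| Start
| Norm of state M
| Tour of nat -> option Act & nat.

(* Every [Tour] state has an outgoing tau-transition, so it adds no stable
   failures: either the trace is in [Div M] and a loop is harmless, or the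
   driven system cannot diverge now and [M] can take over. *)
Inductive sim_trans : sim_state -> option (Act + nat) -> sim_state -> Prop :=
| StartNorm : sim_trans Start None (Norm (initial M))
| StartTour w : touring w -> sim_trans Start None (Tour w 0)
| NormStep s l s' : trans s l s' -> sim_trans (Norm s) (omap inl l) (Norm s')
| TourStep w p : touring w ->
    sim_trans (Tour w p) (Some (oapp inl (inr (skips w p)) (w p))) (Tour w p.+1)
| TourLoop w p : Div M (vis w p) -> sim_trans (Tour w p) None (Tour w p)
| TourExit w p s : ~ B (skips w p) -> weak (initial M) (vis w p) s ->
    sim_trans (Tour w p) None (Norm s).

Lemma sim_alphabet t l t' : sim_trans t (Some l) t' ->
  [set x | if x is inl a then alphabet M a else True] l.
Proof.
move e : (Some l) => k h; case: h e => //.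
  by move=> s [a|//] s' t'' [->] /=; exact: trans_alphabet t''.
move=> w p [hT _ _ _] [->]; case e: (w p) => [a|//] /=.
have [s] := hT p.+1; rewrite visS e; exact: weak_alphabet.
Qed.

Definition simulator : LTS (Act + nat) := MkLTS Start sim_alphabet.

Lemma simulator_cue i : alphabet simulator (inr i).
Proof. by []. Qed.

Variable K : LTS Act.
Hypothesis alphabetK : alphabet K = range cue.
Hypothesis DivK : forall i, B i <-> Div K (mkseq cue i).
Hypothesis B0 : ~ B 0.

Let D := drive g K simulator.
Let q0 := initial K.

Lemma sim_tau (q q' : state K) (t t' : sim_state) :
  @trans _ D (q, t) None (q', t') ->
  (trans q None q' /\ t' = t) \/
  match t with
  | Start => q' = q /\ (t' = Norm (initial M) \/ exists2 w, touring w & t' = Tour w 0)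
  | Norm s => q' = q /\ exists2 s', trans s None s' & t' = Norm s'
  | Tour w p =>
    [\/ [/\ q' = q, Div M (vis w p) & t' = Tour w p],
        [/\ q' = q, ~ B (skips w p) & exists2 s, weak (initial M) (vis w p) s & t' = Norm s] |
        [/\ touring w, w p = None, trans q (Some (cue (skips w p))) q' & t' = Tour w p.+1]]
  end.
Proof.
move=> /(drive_tau g_inj alphabetK simulator_cue)[|[-> h]|[i [tq h]]]; first by left.
  right; move: h; move e : None => l h; case: h e => //.
  - by split=> //; left.
  - by move=> w hw; split=> //; right; exists w.
  - by move=> s [//|] s' h _; split=> //; exists s'.
  - by constructor 1.
  - by move=> w p s nB h _; constructor 2; split=> //; exists s.
right; move: h; move e : (Some _) => l h; case: h e => //.
  by move=> s [].
move=> w p hw; case ew: (w p) => [//|] [ei]; subst i.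
by constructor 3.
Qed.

Lemma sim_vis (q q' : state K) (t t' : sim_state) a :
  @trans _ D (q, t) (Some a) (q', t') ->
  q' = q /\
  match t with
  | Start => False
  | Norm s => exists2 s', trans s (Some a) s' & t' = Norm s'
  | Tour w p => [/\ touring w, w p = Some a & t' = Tour w p.+1]
  end.
Proof.
move=> /(drive_vis g_inj alphabetK)[-> h]; split=> //.
move: h; move e : (Some _) => l h; case: h e => //.
  by move=> s [b|//] s' h [eb]; subst b; exists s'.
by move=> w p hw; case: (w p) => [b|//] [->].
Qed.

Lemma sim_idle (q q' : state K) (t : sim_state) :
  weak q [::] q' -> @weak _ D (q, t) [::] (q', t).
Proof.
apply: (@weak0_ind _ K (fun q' => @weak _ D (q, t) [::] (q', t))); first exact: weak_refl.
move=> q1 q2 h t1; apply: weak_cat h (@weak_step _ D _ None _ _).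
by apply/(drive_tau g_inj alphabetK simulator_cue); constructor 1.
Qed.

Lemma sim_move (q : state K) (t t' : sim_state) (l : option Act) :
  sim_trans t (omap inl l) t' -> @trans _ D (q, t) l (q, t').
Proof.
case: l => [a|] h; first by apply/(drive_vis g_inj alphabetK).
by apply/(drive_tau g_inj alphabetK simulator_cue); constructor 2.
Qed.

(** [Norm] forgets how many cues [K] has performed, but keeps that this number is outside [B], so
    that [K] terminates there. *)
Definition sim_inv (sigma : seq Act) (x : state D) : Prop :=
  match x.2 with
  | Start => sigma = [::] /\ weak q0 [::] x.1
  | Norm s => weak (initial M) sigma s /\
      exists2 i, ~ B i & weak q0 (mkseq cue i) x.1
  | Tour w p => [/\ touring w, sigma = vis w p & weak q0 (mkseq cue (skips w p)) x.1]
  end.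

Lemma sim_inv_step sigma x l x' :
  sim_inv sigma x -> trans x l x' -> sim_inv (sigma ++ letters l) x'.
Proof.
case: x x' => [q t] [q' t']; rewrite /sim_inv /=; case: l => [a|] inv.
  move=> /sim_vis[-> ]; case: t inv => //= [s [hs hq] [s' h ->]|w p [hw -> hq] [_ ew ->]].
    by split=> //; exact: weak_cat hs (weak_step h).
  by split=> //; [rewrite visS ew | rewrite skipsS ew addn0].
rewrite cats0 => /sim_tau[[h ->]|].
  case: t inv => [[? h1]|s [? [i ? h1]]|w p [? ? h1]]; split=> //; try exists i => //;
  exact: weak_cat0 h1 (weak_step h).
case: t inv => [[-> h] [-> [->|[w hw ->]]]|s [hs hq] [-> [s' h ->]]|w p [hw -> hq]].
- by split; [exact: weak_refl | exists 0].
- by split.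
- by split=> //; exact: weak_cat0 hs (weak_step h).
move=> [[-> _ ->]|[-> nB [s hs ->]]|[_ ew h ->]].
- by split.
- by split=> //; exists (skips w p).
split=> //; first by rewrite visS ew cats0.
by rewrite skipsS ew addn1 mkseqS -cats1; exact: weak_cat hq (weak_step h).
Qed.

Lemma sim_inv_weak sigma x rho x' :
  sim_inv sigma x -> weak x rho x' -> sim_inv (sigma ++ rho) x'.
Proof. by move=> h; apply: weak_ind_tail h _; exact: sim_inv_step. Qed.

Lemma sim_reach sigma x : weak (initial D) sigma x -> sim_inv sigma x.
Proof. by apply: (@sim_inv_weak [::]); split=> //; exact: weak_refl. Qed.

Lemma term_of_nonDiv i q : ~ B i -> weak q0 (mkseq cue i) q -> term q.
Proof.
move=> nB h; apply: contrapT => /divergesP d.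
by apply: nB; apply/DivK; exists q.
Qed.

Lemma sim_weak_Norm sigma s : weak (initial M) sigma s ->
  @weak _ D (initial D) sigma (q0, Norm s).
Proof.
move=> h; apply: (@weak_cat _ D _ [::] (q0, Norm (initial M))).
  by apply: (@weak_step _ D _ None); apply: sim_move; exact: StartNorm.
apply: (@weak_map _ M D (fun s => (q0, Norm s))) h => s1 l s2 t.
by apply: weak_step; apply: sim_move; exact: NormStep.
Qed.

(** [Start] and reachable [Tour] states are never stable, so stable failures arise in [Norm]
    only. *)
Lemma sim_Sf : Sf D = Sf M.
Proof.
have eA : alphabet D = alphabet M.
  by rewrite (drive_alphabet g_inj simulator alphabetK).
rewrite /Sf eA; apply/seteqP; split=> -[sigma A] [AM [s h refuse]]; split=> //.
  have := sim_reach h; case: s h refuse => [q t] h refuse.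
  have st := refuse None (or_intror erefl).
  rewrite /sim_inv /=; case: t h refuse st => [|s|w p] h refuse st.
  - by case: (st (q, Norm (initial M))); apply: sim_move; exact: StartNorm.
  - move=> [hs _]; exists s => // l /refuse nl s' t.
    by apply: (nl (q, Norm s')); apply: sim_move; exact: NormStep.
  - move=> [[hT hB _ _] _ _]; case: (pselect (B (skips w p))) => [/hB d|nB].
      by case: (st (q, Tour w p)); apply: sim_move; exact: TourLoop.
    have [s hs] := hT p.
    by case: (st (q, Norm s)); apply: sim_move; exact: TourExit.
(* By [~ B 0], [K] can silently come to rest; the moves left in [Norm s] are then those of [M]. *)
have [q hq stq] := term_stable (term_of_nonDiv B0 (weak_refl q0)).
exists (q, Norm s); first exact: weak_cat0 (sim_weak_Norm h) (sim_idle _ hq).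
move=> l /refuse; case: l => [a|] nl [q' t'].
  by move=> /sim_vis[_ [s' /nl]].
by move=> /sim_tau[[/stq]|[_ [s' /nl]]].
Qed.

Lemma sim_term_Norm q s : term q -> term s -> @term _ D (q, Norm s).
Proof.
move=> tq; elim: tq s => {}q _ IHq s ts; elim: ts => {}s hs IHs.
constructor=> -[q' t'] /sim_tau[[t ->]|[-> [s' t ->]]]; last exact: IHs.
by apply: IHq => //; exact: Acc_intro hs.
Qed.

(** Outside [Div M] a tour cannot loop and its count is outside [B], so [K] terminates between
    hidden steps, and only finitely many of these precede the next letter. *)
Lemma sim_term sigma x : ~ Div M sigma -> sim_inv sigma x -> term x.
Proof.
move=> nD.
have hNorm q s i : ~ B i -> weak q0 (mkseq cue i) q -> weak (initial M) sigma s ->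
    @term _ D (q, Norm s).
  move=> nB hq hs; apply: sim_term_Norm; first exact: term_of_nonDiv hq.
  by apply: contrapT => /divergesP d; apply: nD; exists s.
(* Induction on the distance [k] to a visible label of [w], then on the termination of [K]. *)
have hTour k w q p : touring w -> sigma = vis w p ->
    weak q0 (mkseq cue (skips w p)) q -> isSome (w (p + k)) -> @term _ D (q, Tour w p).
  elim: k q p => [|k IHk] q p hw es hq wk.
    have nB : ~ B (skips w p) by case: hw => _ hB _ _ /hB; rewrite -es.
    move: (term_of_nonDiv nB hq) => tq; elim: tq hq => {}q _ IHq hq.
    constructor=> -[q' t'] /sim_tau[[t ->]|].
      by apply: IHq => //; exact: weak_cat0 hq (weak_step t).
    move=> [[_]|[-> _ [s hs ->]]|[_ ew]]; first by rewrite -es => /nD.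
      by apply: hNorm hq _ => //; rewrite es.
    by move: wk; rewrite addn0 ew.
  have nB : ~ B (skips w p) by case: hw => _ hB _ _ /hB; rewrite -es.
  move: (term_of_nonDiv nB hq) => tq; elim: tq hq => {}q _ IHq hq.
  constructor=> -[q' t'] /sim_tau[[t ->]|].
    by apply: IHq => //; exact: weak_cat0 hq (weak_step t).
  move=> [[_]|[-> _ [s hs ->]]|[_ ew t ->]]; first by rewrite -es => /nD.
    by apply: hNorm hq _ => //; rewrite es.
  apply: IHk => //; rewrite ?addSnnS//; first by rewrite visS ew cats0.
  by rewrite skipsS ew addn1 mkseqS -cats1; exact: weak_cat hq (weak_step t).
have hTour' w q p : touring w -> sigma = vis w p ->
    weak q0 (mkseq cue (skips w p)) q -> @term _ D (q, Tour w p).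
  move=> hw es hq; have [k pk wk] := tour_next p hw.
  by apply: (hTour (k - p)) => //; rewrite subnKC.
case: x => [q [|s|w p]]; rewrite /sim_inv /=; last first.
- by move=> []; exact: hTour'.
- by move=> [hs [i nB hq]]; exact: hNorm hq hs.
move=> [es hq]; have tq := term_of_nonDiv B0 hq.
elim: tq hq => {}q _ IHq hq; constructor=> -[q' t'] /sim_tau[[t ->]|[-> ]].
  by apply: IHq => //; exact: weak_cat0 hq (weak_step t).
move=> [->|[w hw ->]]; last by apply: hTour'.
by apply: (hNorm _ _ 0) => //; rewrite es; exact: weak_refl.
Qed.

Lemma sim_Div : Div D = Div M.
Proof.
apply/seteqP; split=> sigma; last first.
  move=> [s h d]; exists (q0, Norm s); first exact: sim_weak_Norm.
  apply: (@diverges_map _ M D (fun s => (q0, Norm s))) d => s1 s2 t.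
  by apply: sim_move; exact: (NormStep t).
move=> [x /sim_reach h /divergesP nt]; apply: contrapT => nD.
by apply: nt; exact: sim_term h.
Qed.

Lemma sim_Inf_Norm : Inf M `<=` Inf D.
Proof.
move=> xi /InfP[r r0 hr].
apply: (@Inf_eventually _ D (fun n x => x = (q0, Norm (r n))) _ 0 _ (sim_weak_Norm (weak_refl _))).
  by rewrite r0.
move=> n _ ->; exists (q0, Norm (r n.+1)) => //.
apply: (@weak_map _ M D (fun s => (q0, Norm s))) (hr n) => s1 l s2 t.
by apply: weak_step; apply: sim_move; exact: NormStep.
Qed.

(** A run of [K] through all cues has a state ready for each number of hidden steps, so the tour is
    never blocked. *)
Lemma sim_Inf_Tour w xi : touring w -> inf_visible w xi -> Inf K cue -> Inf D xi.
Proof.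
move=> hw wxi /InfP[r r0 hr].
have step p : @weak _ D (r (skips w p), Tour w p) (letters (w p))
    (r (skips w p.+1), Tour w p.+1).
  have := TourStep p hw; rewrite skipsS.
  case: (w p) => [a|] /= t; first by rewrite addn0; apply: weak_step; exact: sim_move.
  rewrite addn1; have [s1 [s2 [h1 tK h2]]] := weak1P (hr (skips w p)).
  have tD : @trans _ D (s1, Tour w p) None (s2, Tour w p.+1).
    apply/(drive_tau g_inj alphabetK simulator_cue); constructor 3.
    by exists (skips w p).
  apply: (@weak_cat _ D _ [::] _ [::] _ (sim_idle _ h1)).
  exact: (weak_cat (weak_step tD) (sim_idle _ h2)).
have [x x0 hx] := run_of_word step wxi.
apply: (@Inf_eventually _ D (fun n s => s = x n) xi 0 (x 0)) => [||n _ ->].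
- rewrite x0 r0; apply: (@weak_step _ D _ None); apply: sim_move.
  exact: StartTour.
- by [].
- by exists (x n.+1).
Qed.

Lemma sim_from_Norm q s sigma x : @weak _ D (q, Norm s) sigma x ->
  exists q' s', x = (q', Norm s') /\ weak s sigma s'.
Proof.
apply: (@weak_ind_tail _ D (fun sg x => exists q' s', x = (q', Norm s') /\ weak s sg s') [::]).
  by exists q, s; split=> //; exact: weak_refl.
move=> sg _ [a|] [q2 t2] [q1 [s1 [-> h1]]].
  by move=> /sim_vis[_ [s2 t ->]]; exists q2, s2; split=> //; exact: weak_cat h1 (weak_step t).
rewrite cats0 => /sim_tau[[_ ->]|[_ [s2 t ->]]]; first by exists q2, s1.
by exists q2, s2; split=> //; exact: weak_cat0 h1 (weak_step t).
Qed.

Lemma sim_from_Tour q w p sigma x : @weak _ D (q, Tour w p) sigma x ->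
  (exists q' s', x = (q', Norm s')) \/
  exists q' p' u, [/\ x = (q', Tour w p'),
    mkseq cue (skips w p') = mkseq cue (skips w p) ++ u & weak q u q'].
Proof.
apply: (@weak_ind_tail _ D (fun _ x => (exists q' s', x = (q', Norm s')) \/
  exists q' p' u, [/\ x = (q', Tour w p'),
    mkseq cue (skips w p') = mkseq cue (skips w p) ++ u & weak q u q']) [::]).
  by right; exists q, p, [::]; rewrite cats0; split=> //; exact: weak_refl.
move=> _ _ l [q2 t2] [[q1 [s1 ->]]|[q1 [p1 [u [-> eu hu]]]]] t.
  left; have [q3 [s3 [-> _]]] := sim_from_Norm (weak_step t).
  by exists q3, s3.
case: l t => [a|].
  move=> /sim_vis[-> [_ ew ->]]; right; exists q1, p1.+1, u.
  by rewrite skipsS ew addn0.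
move=> /sim_tau[[t ->]|[[-> _ ->]|[_ _ [s _ ->]]|[_ ew t ->]]].
- by right; exists q2, p1, u; split=> //; exact: weak_cat0 hu (weak_step t).
- by right; exists q1, p1, u.
- by left; exists q2, s.
right; exists q2, p1.+1, (u ++ [:: cue (skips w p1)]); split=> //.
  by rewrite skipsS ew addn1 mkseqS -cats1 eu catA.
exact: weak_cat hu (weak_step t).
Qed.

(** A run reaching [Norm] stays there and follows [M]; any other keeps to a single tour, whose
    infinitely many hidden steps take [K] through all cues. *)
Lemma sim_Inf_inv xi : Inf D xi ->
  Inf M xi \/ (Inf K cue /\ exists2 w, touring w & inf_visible w xi).
Proof.
move=> /InfP[r r0 hr].
have seg n k : exists sigma, weak (r n) sigma (r (n + k)).
  elim: k => [|k [sg h]]; first by exists [::]; rewrite addn0; exact: weak_refl.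
  by exists (sg ++ [:: xi (n + k)]); rewrite addnS; exact: weak_cat h (hr _).
have inv n : sim_inv (mkseq xi n) (r n).
  elim: n => [|n IH]; first by rewrite r0; apply: sim_reach; exact: weak_refl.
  by rewrite mkseqS -cats1; exact: sim_inv_weak IH (hr n).
case: (pselect (exists n q s, r n = (q, Norm s))) => [[n [q [s e]]]|nNorm].
  left; have := inv n; rewrite e /sim_inv /= => -[hs _].
  apply: (Inf_eventually (P := fun m s => exists q, r m = (q, Norm s)) hs).
    by exists q.
  move=> m s1 [q1 e1]; have := hr m; rewrite e1.
  by move=> /sim_from_Norm[q2 [s2 [e2 h2]]]; exists s2 => //; exists q2.
right.
(* At index [n.+1] the trace is nonempty, which excludes [Start]. *)
have inTour n : exists w q p, r n.+1 = (q, Tour w p).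
  case e: (r n.+1) (inv n.+1) => [q [|s|w p]]; rewrite /sim_inv /=; last first.
  - by exists w, q, p.
  - by case: nNorm; exists n.+1, q, s.
  - by rewrite mkseqS -cats1; case: mkseq => [|??] [].
have [w [q1 [p1 e1]]] := inTour 0.
have onTour n : exists q p, r n.+1 = (q, Tour w p).
  have [sg] := seg 1 n; rewrite add1n e1 => /sim_from_Tour[[q [s e]]|].
    by case: nNorm; exists n.+1, q, s.
  by move=> [q [p [u [-> _ _]]]]; exists q, p.
have onTourP n q p : r n.+1 = (q, Tour w p) ->
    [/\ touring w, vis w p = mkseq xi n.+1 & weak q0 (mkseq cue (skips w p)) q].
  by move=> e; have := inv n.+1; rewrite e /sim_inv /= => -[].
have [hw _ h1] := onTourP _ _ _ e1.
split; last first.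
  exists w => //; apply/inf_visibleP => -[|n]; first by exists 0.
  by have [q [p /onTourP[_ hp _]]] := onTour n; exists p.
(* [q] is reached after [m] cues, and [u] collects the cues from there to the state of [K] in
   [r n.+1]. *)
pose P m q := exists n q' p u, [/\ r n.+1 = (q', Tour w p),
  mkseq cue (skips w p) = mkseq cue m ++ u & weak q u q'].
apply: (Inf_eventually (P := P) h1).
  by exists 0, q1, p1, [::]; rewrite cats0; split=> //; exact: weak_refl.
move=> m q [n [q2 [p2 [u [e2 eu hu]]]]].
have [pm hpm] : exists p, m < skips w p by case: hw => _ _ _ /(_ m.+1).
(* By then more letters have appeared than before position [pm], so the tour is past [pm] and
   [cue m] has been performed. *)
have [q3 [p3 e3]] := onTour (n + size (vis w pm)).
have lt_p : pm < p3.
  apply: (@leq_of_size_vis _ w).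
  by have [_ -> _] := onTourP _ _ _ e3; rewrite size_mkseq; lia.
have [sg] := seg n.+1 (size (vis w pm)); rewrite addSn e3 e2.
move=> /sim_from_Tour[[q' [s []]] //|[q3' [p3' [u' [[<- <-] eu' hu']]]]].
move: eu'; rewrite eu -catA.
have lt_m : m < skips w p3 by exact: leq_trans hpm (leq_skips _ (ltnW lt_p)).
rewrite -[skips w p3](subnKC lt_m) mkseq_cat mkseqS -cats1 -catA.
move=> /(congr1 (drop m)); rewrite !drop_size_cat ?size_mkseq// => e.
have := weak_cat hu hu'; rewrite -e => /weak_split[q4 h4 h4'].
exists q4 => //; exists (n + size (vis w pm)), q3, p3.
eexists; split; [exact: e3 | | exact: h4'].
by rewrite -mkseq_cat subnKC.
Qed.

End Simulation.

(** * Absorbing infinite traces by driving *)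

Section Absorption.
Variables (Act : Type) (g : Act + nat -> Act).
Hypothesis g_inj : injective g.

Notation cue := (cue g).

Lemma Tr_prefix (L : LTS Act) xi n : Inf L xi -> Tr L (mkseq xi n).
Proof.
move=> /InfP[r r0 hr]; exists (r n).
elim: n => [|n IH]; first by rewrite r0; exact: weak_refl.
by rewrite mkseqS -cats1; exact: weak_cat IH (hr n).
Qed.

Variable R : LTS Act -> LTS Act -> Prop.
Hypothesis R_cong : congruence R.
Hypothesis R_cffd : forall L L' : LTS Act, cffd L L' -> R L L'.
Variables K K' : LTS Act.
Hypotheses (RK : R K K') (alphabetK : alphabet K = range cue)
  (alphabetK' : alphabet K' = range cue) (DivK' : Div K = Div K')
  (DivK0 : ~ Div K [::]) (InfK : Inf K cue) (InfK' : ~ Inf K' cue)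
  (nonDivK : forall n, exists2 i, n <= i & ~ Div K (mkseq cue i)).

Let B : set nat := [set i | Div K (mkseq cue i)].
Let D M := drive g K (simulator M B).

Lemma BK i : B i <-> Div K (mkseq cue i).
Proof. by []. Qed.

Lemma BK' i : B i <-> Div K' (mkseq cue i).
Proof. by rewrite -DivK'. Qed.

Lemma alphabet_drive_sim C M : alphabet C = range cue ->
  alphabet (drive g C (simulator M B)) = alphabet M.
Proof. by move=> eC; rewrite (drive_alphabet g_inj (simulator M B) eC). Qed.

(** As [K'] cannot follow all cues, no tour of it lasts forever and driving it yields [M] up to
    [cffd]; congruence then replaces [K'] by [K]. *)
Lemma R_drive_sim M : R M (D M).
Proof.
have [_ sym trans] := cong_equiv R_cong.
apply: (trans _ (drive g K' (simulator M B))); last first.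
  by apply: sym; exact: drive_cong.
apply: R_cffd; split.
- by rewrite alphabet_drive_sim.
- by rewrite (sim_Sf g_inj _ alphabetK' BK' DivK0).
- by rewrite (sim_Div g_inj _ alphabetK' BK' DivK0).
apply/seteqP; split; first exact: sim_Inf_Norm.
by move=> xi /(sim_Inf_inv g_inj alphabetK' DivK0)[|[]].
Qed.

(** An infinite trace of [M] outside [eanI M] has infinitely many prefixes in [Div M], so some tour
    shows it; and tours depend on [Tr] and [Div] only. *)
Lemma R_of_eanI M M' : alphabet M = alphabet M' -> Sf M = Sf M' ->
  Div M = Div M' -> eanI M = eanI M' -> R M M'.
Proof.
move=> eA eSf eDiv eI.
have eTr : Tr M = Tr M'.
  by apply/seteqP; split=> sigma /TrE; rewrite ?eSf ?eDiv => h; apply/TrE; rewrite ?eSf ?eDiv.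
have sub N N' : Tr N = Tr N' -> Div N = Div N' -> eanI N = eanI N' ->
    Inf (D N) `<=` Inf (D N').
  move=> eT eD eE xi /(sim_Inf_inv g_inj alphabetK DivK0)[h|[_ [w]]]; last first.
    rewrite eT eD => hw wxi; exact: (sim_Inf_Tour g_inj alphabetK hw wxi InfK).
  case: (pselect (exists n, forall i, n <= i -> ~ Div N (mkseq xi i))) => [ean|ndiv].
    have : eanI N xi by split.
    by rewrite eE => -[h' _]; exact: (sim_Inf_Norm g_inj B alphabetK).
  have [||n||w hw wxi] := @tour_exists _ (Tr N') (Div N') B xi.
  - by move=> n; rewrite -eT; exact: Tr_prefix.
  - move=> n; apply: contrapT => h'; apply: ndiv; exists n => i ni d.
    by apply: h'; exists i => //; rewrite -eD.
  - exact: DivK0.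
  - exact: nonDivK.
  exact: (sim_Inf_Tour g_inj alphabetK hw wxi InfK).
have [_ sym trans] := cong_equiv R_cong.
apply: (trans _ (D M)); first exact: R_drive_sim.
apply: (trans _ (D M')); last by apply: sym; exact: R_drive_sim.
apply: R_cffd; split.
- by rewrite !alphabet_drive_sim.
- by rewrite !(sim_Sf g_inj _ alphabetK BK DivK0).
- by rewrite !(sim_Div g_inj _ alphabetK BK DivK0).
by apply/seteqP; split; exact: sub.
Qed.

End Absorption.

(** * Alphabets, coding of actions and the characterisation of [R] *)

Definition stop (Act : Type) (A : set Act) : LTS Act :=
  @MkLTS Act unit A (fun _ _ _ => False) tt (fun _ _ _ h => False_ind _ h).

Lemma alphabet_preserved (Act : Type) (Act_inf : infinite_set [set: Act])
    (R : LTS Act -> LTS Act -> Prop) (R_cong : congruence R)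
    (R_Sf : preserves (@Sf Act) R) : preserves (@alphabet Act) R.
Proof.
suff H L L' : R L L' -> alphabet L `<=` alphabet L'.
  move=> L L' RL; apply/seteqP; split; first exact: H.
  by apply: H; have [_ sym _] := cong_equiv R_cong; exact: sym.
move=> RL x Lx.
(* Prefix and [stop] both add [b] to the alphabet, so [b] must differ from the action [x] under
   test. *)
have [b xb] : exists b, b <> x.
  apply: contrapT => h; apply: Act_inf; apply: (sub_finite_set _ (finite_set1 x)) => y _.
  by apply: contrapT => yx; apply: h; exists y.
(* [b.L || stop {b}] is deadlocked, so its refusals show its alphabet. *)
have := R_Sf _ _ (cong_parl R_cong (stop [set b]) (cong_act_prefix R_cong b RL)).
move=> /seteqP[/(_ ([::], [set x])) + _] => -[|/= /(_ x erefl)[[//|/esym]|/esym] _] //.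
split; first by move=> _ ->; left; left.
exists (None, tt); first exact: weak_refl.
move=> l hl [s' u'] /par_trans_inv[[_ _ []]|[nsh h _]|[_ _ []]].
apply: nsh; inversion h; subst; apply/shared_some; split=> //.
by right.
Qed.

(** As in Hilbert's hotel, the members of a sequence [e] of distinct actions move to its even
    places, and the odd places receive the numbers. *)
Lemma sum_nat_injection (Act : Type) : infinite_set [set: Act] ->
  exists g : Act + nat -> Act, injective g.
Proof.
move=> /infiniteP/card_leP[f]; pose e n : Act := val (f (to_setT n)).
have e_inj : injective e.
  by move=> m n /val_inj/(inj (in_setT _) (in_setT _))/(congr1 val).
have /choice[h hh] : forall a, exists b,
    (exists2 n, a = e n & b = e n.*2) \/ ((forall n, a <> e n) /\ b = a).
  move=> a; case: (pselect (exists n, a = e n)) => [[n an]|na].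
    by exists (e n.*2); left; exists n.
  by exists a; right; split=> // n an; apply: na; exists n.
exists (fun x => match x with inl a => h a | inr n => e n.*2.+1 end).
have h_odd a n : h a <> e n.*2.+1.
  by case: (hh a) => [[m _ ->] /e_inj|[h1 ->] /h1 //]; lia.
move=> [a|m] [b|n].
- case: (hh a) (hh b) => [[m -> ->]|[h1 ->]] [[n -> ->]|[h2 ->]].
  + by move=> /e_inj/double_inj->.
  + by move=> /esym/h2.
  + by move=> /h1.
  + by move=> ->.
- by move=> /h_odd.
- by move=> /esym/h_odd.
- by move=> /e_inj [] /double_inj->.
Qed.

(* The hypothesis [Act_inf] expresses that actions are an unlimited supply;
   every alphabet is a subset of [Act], possibly infinite. *)
Theorem theorem6p16 (Act : Type) (Act_inf : infinite_set [set: Act])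
    (R : LTS Act -> LTS Act -> Prop)
    (R_cong : congruence R)
    (R_cffd : forall L L' : LTS Act, cffd L L' -> R L L')
    (R_Sf : preserves (@Sf Act) R)
    (R_Div : preserves (@Div Act) R)
    (R_aenI : ~ preserves (@aenI Act) R) :
  forall L L' : LTS Act,
    R L L' <->
    [/\ alphabet L = alphabet L', Sf L = Sf L', Div L = Div L' &
        eanI L = eanI L'].
Proof.
have [g g_inj] := sum_nat_injection Act_inf.
have R_alphabet := alphabet_preserved Act_inf R_cong R_Sf.
have R_eanI := eanI_preserved g_inj R_cong R_alphabet R_Div.
move=> M M'; split=> [RM|[eA eSf eDiv eI]].
  by split; [exact: R_alphabet | exact: R_Sf | exact: R_Div | exact: R_eanI].
have [L [L' [RL [xi [hxi hxi']]]]] : exists L L', R L L' /\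
    exists xi, aenI L xi /\ ~ aenI L' xi.
  apply: contrapT => h; apply: R_aenI.
  suff H L L' : R L L' -> aenI L `<=` aenI L'.
    move=> L L' RL; apply/seteqP; split; first exact: H.
    by apply: H; have [_ sym _] := cong_equiv R_cong; exact: sym.
  move=> RL xi hxi; apply: contrapT => hxi'; apply: h.
  by exists L, L'; split=> //; exists xi.
have [ixi cofin] := hxi.
(* [Div] agrees on [L] and [L'], so [xi] can fail to be in [aenI L'] only by not being in
   [Inf L']. *)
have ixi' : ~ Inf L' xi.
  by move=> h; apply: hxi'; split=> // n; rewrite -(R_Div _ _ RL); exact: cofin.
have xiL i := Inf_alphabet i ixi.
have xiL' i : alphabet L' (xi i) by rewrite -(R_alphabet _ _ RL).
have RK := track_cong g xi R_cong RL.
apply: (R_of_eanI g_inj R_cong R_cffd RK) => //.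
- exact: track_alphabet.
- exact: track_alphabet.
- exact: R_Div.
- exact: track_Div0.
- exact/track_Inf.
- by move/(track_Inf g_inj).
(* The shift to [i.+1] accounts for the leading [cue 0]. *)
move=> n; have [i ni nD] := cofin n; exists i.+1; first exact: leqW.
by move=> /(track_Div g_inj).
Qed.
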